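(* Let $m>1$ be an integer and let $k\ge 1$, $\epsilon>0$ be real numbers. Then there exists a path-connected topological design problem with $M=m$ and $K\le k+\epsilon$ that admits no design of size $(m-1)(k+1)$ or less.
   Context: A topological design problem is a triple $(X,\mu,W)$ where $X$ is a topological space with its Borel $\sigma$-algebra, $\mu$ is a positive measure on it with $\mu(X)=1$, and $W$ is a finite-dimensional real vector space of bounded continuous functions $X\to\mathbb{R}$. It is path-connected if $X$ is path-connected. A design of size $N$ ($N\ge 1$ an integer) is a list of $N$ points $p_1,\dots,p_N\in X$ (not necessarily distinct) with $\int_X f\,d\mu=\frac1N\sum_{i=1}^N f(p_i)$ for all $f\in W$. Let $V$ be the space of all $f\in W+\langle 1\rangle$ (where $1$ is the constant function) with $\int_X f\,d\mu=0$, let $M=\dim V$, and let $$K=\sup_{f\in V\setminus\{0\}}\frac{\sup(f)}{|\inf(f)|}\in[0,\infty],$$ where a ratio with positive numerator and zero denominator is $+\infty$. *)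

(* Defs.v *)
From HB Require Import structures.
From mathcomp Require Import all_boot all_order all_algebra.
From mathcomp Require Import all_classical all_reals all_analysis.

Set Implicit Arguments.
Unset Strict Implicit.
Unset Printing Implicit Defensive.

Import Order.TTheory GRing.Theory Num.Theory.
Import numFieldNormedType.Exports.
Local Open Scope classical_set_scope.
Local Open Scope ring_scope.

Definition borelType (X : ptopologicalType) := g_sigma_algebraType (@open X).

(* [S] is a linear subspace of dimension [n]: the linear span of a linearly
   independent family of [n] vectors. *)
Definition has_dim (R : pzRingType) (E : lmodType R) (S : set E) (n : nat) :=
  exists b : 'I_n -> E,
    (forall c : 'I_n -> R, \sum_i c i *: b i = 0 -> forall i, c i = 0) /\
    S = [set \sum_i c i *: b i | c in [set: 'I_n -> R]].

Definition path_connected (R : realType) (X : topologicalType) :=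
  forall x y : X, exists gamma : R -> X,
    [/\ {within `[0, 1]%classic, continuous gamma}, gamma 0 = x & gamma 1 = y].

(* Pointedness of the space is required by [measurableType] and loses no
   generality, as a space carrying a probability measure is nonempty. *)
Record design_problem (R : realType) := DesignProblem {
  dp_space :> ptopologicalType ;
  dp_measure : probability (borelType dp_space) R ;
  dp_functions : set (dp_space -> R) ;
  dp_finite_dim : exists n, has_dim dp_functions n ;
  dp_continuous : forall f, dp_functions f -> continuous f ;
  dp_bounded : forall f, dp_functions f -> bounded_fun f
}.
Arguments dp_measure {R} P : rename.
Arguments dp_functions {R} P : rename.

Section DesignProblemTheory.
Context {R : realType} (P : design_problem R).

Definition dp_integral (f : P -> R) : \bar R :=
  (\int[dp_measure P]_x (f x)%:E)%E.

Definition is_design (N : nat) (p : 'I_N -> P) :=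
  (0 < N)%N /\
  forall f, dp_functions P f ->
    dp_integral f = (N%:R^-1 * \sum_(i < N) f (p i))%:E.

Definition admits_design (N : nat) := exists p : 'I_N -> P, is_design p.

Definition dp_V : set (P -> R) :=
  [set f | (exists2 g, dp_functions P g & exists c : R, f = g + cst c) /\
           dp_integral f = 0%E].

(* In [\bar R], [0%:E^-1 = +oo] and [a%:E * +oo = +oo] for [0 < a], so a ratio
   with positive numerator and zero denominator is [+oo]. *)
Definition dp_K : \bar R :=
  ereal_sup [set ((sup (range f))%:E / `|inf (range f)|%:E)%E
            | f in dp_V `\ (0 : P -> R)].

End DesignProblemTheory.

Arguments dp_V {R} P.
Arguments dp_K {R} P.
Arguments admits_design {R} P N.

(* Main.v *)
Require Import Defs.
From HB Require Import structures.
From mathcomp Require Import all_boot all_order all_algebra.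
From mathcomp Require Import all_classical all_reals all_analysis.
From mathcomp Require Import measurable_realfun ring lra.
Import Order.TTheory GRing.Theory Num.Theory.
Import numFieldNormedType.Exports.
Local Open Scope classical_set_scope.
Local Open Scope ring_scope.

(* Write m = n + 1. On the real line, take coordinates f_0 with values in [0, 1]
   and f_1, ..., f_n with values in [-1, 1] such that
   - at each point at most one of f_1, ..., f_n is not an integer, and none of
     them is where f_0 <> 1;
   - the image of (f_0, ..., f_n) contains all the points (0, +-e_i) and
     (1, +-e_i), so that its convex hull is [0, 1] times the cross-polytope.
   Choose a measure with finite support and mean (c, delta, ..., delta), where c
   is slightly less than 1 / (k + 1) and delta is tiny. Since the hull is nearly
   symmetric in the directions f_1, ..., f_n, the largest ratio is that of
   f_0 - c, namely (1 - c) / c, which is slightly more than k.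
   In a design of size N <= n (k + 1) the sum of f_0 is N c < n, so fewer than n
   points satisfy f_0 = 1. These are the only points with a non-integral
   coordinate, and each has at most one, so some f_i with 0 < i is integral at all
   points of the design; but its sum N delta lies strictly between 0 and 1. *)

Set Implicit Arguments.
Unset Strict Implicit.
Unset Printing Implicit Defensive.

(** * Probability measures with finite support *)

Section MassOne.
Context d (T : measurableType d) (R : realType).
Context (nu : {measure set T -> \bar R}).

(** The proof of total mass 1 is an argument of this alias, so that a probability structure can be
    attached to it. *)
Definition mass_one_of & nu setT = 1%E : set T -> \bar R := nu.

Hypothesis nuT : nu setT = 1%E.

HB.instance Definition _ := Measure.on (mass_one_of nuT).
HB.instance Definition _ :=
  @Measure_isProbability.Build _ _ _ (mass_one_of nuT) nuT.

Definition measure_probability : probability T R := mass_one_of nuT.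

End MassOne.

(** The measure is a weighted sum of Dirac masses. Integrals are computed first for nonnegative
    functions, then for [f] through its positive and negative parts. *)
Lemma finitely_supported_probability d (T : measurableType d) (R : realType)
    (n : nat) (w : nat -> {nonneg R}) (a : nat -> T) :
  \sum_(j < n) (w j)%:num = 1 ->
  exists mu : probability T R, forall f : T -> R, measurable_fun setT f ->
    (\int[mu]_x (f x)%:E)%E = (\sum_(j < n) (w j)%:num * f (a j))%:E.
Proof.
move=> w1; pose nu : {measure set T -> \bar R} :=
  msum (fun j => mscale (w j) \d_(a j)) n.
have nuT : nu setT = 1%E.
  rewrite /nu/= /msum/= -[1%E]/(1%:E) -w1 -sumEFin; apply: eq_bigr => j _.
  by rewrite /mscale/= diracT mule1.
pose mu := measure_probability nuT.
have int_ge0 (g : T -> \bar R) :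
    measurable_fun setT g -> (forall x, 0 <= g x)%E ->
    (\int[mu]_x g x = \sum_(j < n) (w j)%:num%:E * g (a j))%E.
  move=> mg g0; rewrite ge0_integral_measure_sum//; apply: eq_bigr => j _.
  by rewrite ge0_integral_mscale// integral_dirac// diracT mul1e.
exists mu => f mf.
have mfE : measurable_fun setT (EFin \o f) by exact/measurable_EFinP.
have mfp : measurable_fun setT (EFin \o f^\+).
  by rewrite -funerpos; exact: measurable_funepos.
have mfn : measurable_fun setT (EFin \o f^\-).
  by rewrite -funerneg; exact: measurable_funeneg.
rewrite integralE [(fun x => _)^\+%E]funerpos [(fun x => _)^\-%E]funerneg.
rewrite !int_ge0 => // [|x|x]; last 2 first.
- by rewrite lee_fin funrneg_ge0.
- by rewrite lee_fin funrpos_ge0.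
rewrite !sumEFin -EFinB -sumrB; congr EFin; apply: eq_bigr => j _.
by rewrite -mulrBr -[in RHS](funrposBneg f).
Qed.

(** * Measurability and continuity *)

Lemma continuous_borel_measurable (X : ptopologicalType) (R : realType)
    (f : X -> R) :
  continuous f -> measurable_fun (setT : set (borelType X)) f.
Proof.
move=> cf; apply: (measurability _ (RGenOpens.measurableE R)).
move=> _ [_ [a [b ->]] <-]; rewrite setTI; apply: sub_sigma_algebra.
by apply: open_comp => [x _|]; [exact: cf|exact: interval_open].
Qed.

Lemma sum_continuous (X : topologicalType) (R : realType) n
    (f : 'I_n -> X -> R) :
  (forall i, continuous (f i)) -> continuous (fun x => \sum_(i < n) f i x).
Proof.
by move=> cf x; apply: cvg_big => [|i _]; [exact: add_continuous|exact: cf].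
Qed.

(** * Piecewise linear coordinates on the real line *)

Section Coordinates.
Context {R : realType}.
Implicit Types (x : R) (j n : nat).

Definition relu x : R := Num.max x 0.
(** Around [4 j], [spike] is a tent of radius 1, while [plateau] is 1 up to distance 1 and falls
    linearly to 0 at distance 2. So [spike] is nonzero only where [plateau] is 1, and plateaus of
    different indices have disjoint open supports. *)
Definition spike j x := relu (1 - `|x - 4 * j%:R|).
Definition plateau j x := relu (2 - `|x - 4 * j%:R|) - spike j x.

Lemma spike_ge0 j x : 0 <= spike j x.
Proof. by rewrite /spike /relu le_max lexx orbT. Qed.

Lemma spike_le1 j x : spike j x <= 1.
Proof. by rewrite /spike /relu ge_max ler01 andbT gerBl. Qed.

Lemma plateau_itv j x : 0 <= plateau j x <= 1.
Proof. by rewrite /plateau /spike /relu /Num.max; do 2 case: ltP => ?; lra. Qed.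

Lemma plateau_eq1 j x : `|x - 4 * j%:R| <= 1 -> plateau j x = 1.
Proof.
by move=> ?; rewrite /plateau /spike /relu /Num.max; do 2 case: ltP => ?; lra.
Qed.

Lemma spike_eq0 j x : 1 <= `|x - 4 * j%:R| -> spike j x = 0.
Proof. by move=> ?; rewrite /spike /relu; apply/max_idPr; lra. Qed.

Lemma plateau_eq0 j x : 2 <= `|x - 4 * j%:R| -> plateau j x = 0.
Proof.
move=> ?; rewrite /plateau spike_eq0 ?subr0; last by lra.
by rewrite /relu; apply/max_idPr; lra.
Qed.

Lemma spike_center j : spike j (4 * j%:R) = 1.
Proof. by rewrite /spike subrr normr0 subr0; apply/max_idPl. Qed.

(* Around [4 j], for [j = 2 i] or [j = 2 i + 1] with [0 < i], the [i]-th
   coordinate rises from 0 to 1, resp. falls from 0 to -1; once it is there, the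
   0-th coordinate dips from 1 to 0 and back. *)
Definition coord n i x : R :=
  if i == 0%N then 1 - \sum_(j < n.+1.*2) spike j x
  else plateau i.*2 x - plateau i.*2.+1 x.

(** At such [x] all spikes and plateaus except the [j]-th vanish, so all coordinates are read off
    from [j]. Every real has such a [j], possibly beyond the range of spikes used by [coord]. *)
Definition isolated j x := forall i, i != j -> 2 <= `|x - 4 * i%:R|.

Lemma isolated_near j x : `|x - 4 * j%:R| <= 2 -> isolated j x.
Proof.
rewrite ler_norml => /andP[xj1 xj2] i; rewrite neq_ltn ler_normr.
case/orP; rewrite -(ler_nat R) -natr1 => ij; apply/orP; [left|right]; lra.
Qed.

Lemma isolated_ex x : exists j, isolated j x.
Proof.
have [[j xj]|no] := pselect (exists j, `|x - 4 * j%:R| <= 2).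
  by exists j; exact: isolated_near.
exists 0%N => i _; rewrite leNgt; apply/negP => /ltW xi; apply: no.
by exists i.
Qed.

Lemma coord0_isolated n j x : isolated j x ->
  coord n 0 x = 1 - (j < n.+1.*2)%:R * spike j x.
Proof.
move=> jx; rewrite /coord eqxx; congr (_ - _).
have far i : i != j -> spike i x = 0.
  by move=> /jx ?; apply: spike_eq0; lra.
have [jn|nj] := ltnP j n.+1.*2; last first.
  rewrite mul0r big1// => i _; apply: far.
  by rewrite neq_ltn (leq_trans (ltn_ord i)).
by rewrite (bigD1 (Ordinal jn))//= mul1r big1 ?addr0// => i ij; exact: far.
Qed.

Lemma coordS_isolated n j x i : isolated j x ->
  coord n i.+1 x = (j./2 == i.+1)%:R * (-1) ^+ odd j * plateau j x.
Proof.
move=> jx.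
have -> : coord n i.+1 x = plateau i.+1.*2 x - plateau i.+1.*2.+1 x by [].
have far l : l != j -> plateau l x = 0 by move=> /jx; exact: plateau_eq0.
have [ji|ji] := eqVneq j./2 i.+1; last first.
  rewrite !mul0r !far ?subrr//; apply: contra_neq ji => <-.
    by rewrite -add1n (half_bit_double _ true).
  by rewrite doubleK.
have := odd_double_half j; rewrite ji mul1r; case: (odd j) => jE.
  rewrite add1n in jE; rewrite far; last by rewrite -jE ltn_eqF.
  by rewrite jE sub0r mulN1r.
rewrite add0n in jE; rewrite [X in _ - X]far; last by rewrite -jE gtn_eqF.
by rewrite jE subr0 mul1r.
Qed.

Lemma coord0_itv n x : 0 <= coord n 0 x <= 1.
Proof.
have [j jx] := isolated_ex x; rewrite (coord0_isolated _ jx).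
by have := spike_ge0 j x; have := spike_le1 j x; case: (_ < _)%N => /= *; lra.
Qed.

(** If the 0-th coordinate is not 1, the [j]-th spike is nonzero, so [x] is within distance 1 of
    [4 j], where the plateau is constantly 1. *)
Lemma coordS_int n i x : coord n 0 x != 1 -> coord n i.+1 x \is a Num.int.
Proof.
have [j jx] := isolated_ex x.
rewrite (coord0_isolated _ jx) (coordS_isolated _ _ jx) => jn1.
rewrite plateau_eq1 ?mulr1; last first.
  rewrite leNgt; apply: contra jn1 => /ltW /spike_eq0 ->.
  by rewrite mulr0 subr0.
by rewrite rpredM ?rpred_nat// rpredX// rpredN rpred1.
Qed.

(** A non-integral coordinate is nonzero, which determines its index as half of [j]. *)
Lemma coordS_inj n i i' x :
  coord n i.+1 x \isn't a Num.int -> coord n i'.+1 x \isn't a Num.int -> i = i'.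
Proof.
have [j jx] := isolated_ex x; rewrite !(coordS_isolated _ _ jx).
have [->|] := eqVneq j./2 i.+1; last by rewrite !mul0r rpred0.
by have [[->]|] := eqVneq i.+1 i'.+1; last by rewrite !mul0r rpred0.
Qed.

Lemma coord_norm_le1 n i x : `|coord n i x| <= 1.
Proof.
case: i => [|i]; first by have := coord0_itv n x; rewrite ler_norml; lra.
have [j jx] := isolated_ex x; rewrite (coordS_isolated _ _ jx).
have := plateau_itv j x; rewrite ler_norml; set p := plateau j x => ?.
by case: (_ == _); case: odd; rewrite /= ?expr0 ?expr1; lra.
Qed.

(** At most one term of the sum is nonzero at [x]. *)
Lemma coord_sum_le n (b : 'I_n -> R) (B : R) x : 0 <= B ->
  (forall k, `|b k| <= B) -> \sum_(i < n) b i * coord n i.+1 x <= B.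
Proof.
move=> B0 bB; have [j jx] := isolated_ex x.
have [[i ji]|no] := pselect (exists i : 'I_n, j./2 == i.+1); last first.
  rewrite big1// => i _; rewrite (coordS_isolated _ _ jx).
  have -> : (j./2 == i.+1) = false by apply/negP => ?; apply: no; exists i.
  by rewrite !mul0r mulr0.
rewrite (bigD1 i)//= big1 ?addr0 => [|i' i'i]; last first.
  rewrite (coordS_isolated _ _ jx) (eqP ji) eqSS (_ : (_ == _) = false).
    by rewrite !mul0r mulr0.
  by apply/negbTE; rewrite eq_sym.
apply: le_trans (ler_norm _) _; rewrite normrM -[leRHS]mulr1.
by apply: ler_pM => //; exact: coord_norm_le1.
Qed.

Lemma coord_continuous n i : continuous (coord n i).
Proof.
have relu_cont : continuous relu.
  move=> x; apply: (@continuous_max _ _ id (cst 0)) => //.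
  exact: cst_continuous.
have norm_cont (c : R) j : continuous (fun x => relu (c - `|x - 4 * j%:R|)).
  rewrite -[X in continuous X]/(relu \o (fun y => c - `|y - 4 * j%:R|)) => x.
  apply: continuous_comp; last exact: relu_cont.
  apply: continuousB; first exact: cst_continuous.
  apply: (@continuous_comp _ _ _ (fun y : R => y - 4 * j%:R) Num.norm);
    last exact: norm_continuous.
  by apply: continuousB => //; exact: cst_continuous.
have plateau_cont j : continuous (plateau j).
  by move=> x; exact: (cvgB (norm_cont 2 j x) (norm_cont 1 j x)).
case: i => [|i] x; last exact: (cvgB (plateau_cont _ x) (plateau_cont _ x)).
have sum_cont := sum_continuous (fun j : 'I_n.+1.*2 => norm_cont 1 j).
exact: (cvgB (cvg_cst (1 : R)) (sum_cont x)).
Qed.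

End Coordinates.

(** * The space spanned by the centered coordinates *)

Section Example.
Context {R : realType} (n : nat) (c delta : R).
Implicit Types (x : R).

Definition mean (i : 'I_n.+1) : R := if i == ord0 then c else delta.

Definition centered (i : 'I_n.+1) x : R := coord n i x - mean i.

Lemma centered_combE (b : 'I_n.+1 -> R) x :
  \sum_i b i * centered i x = b ord0 * (coord n 0 x - c) +
    \sum_(i < n) b (lift ord0 i) * coord n i.+1 x -
    delta * \sum_(i < n) b (lift ord0 i).
Proof.
rewrite big_ord_recl -addrA mulr_sumr -sumrB; congr (_ + _).
apply: eq_bigr => i _; rewrite /centered /mean /=.
by rewrite mulrBr (mulrC delta).
Qed.

Lemma no_centered_zero_sum N (p : 'I_N -> R) :
  N%:R * c < n%:R -> 0 < N%:R * delta < 1 ->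
  ~ (forall i, \sum_(j < N) centered i (p j) = 0).
Proof.
move=> Nc /andP[Nd0 Nd1] p0.
have sumE (i : 'I_n.+1) : \sum_(j < N) coord n i (p j) = N%:R * mean i.
  have := p0 i; rewrite /centered sumrB sumr_const card_ord.
  rewrite -[mean i *+ _]mulr_natl.
  by move/eqP; rewrite subr_eq0 => /eqP.
pose S := [set j | coord n 0 (p j) == 1]%SET.
have Sn : (#|S| < n)%N.
  rewrite -(ltr_nat R); apply: le_lt_trans Nc; rewrite -(sumE ord0).
  rewrite -sumr_const [leRHS](bigID (mem S))/= -[leLHS]addr0 lerD//.
    by apply: ler_sum => j; rewrite inE => /eqP ->.
  by apply: sumr_ge0 => j _; case/andP: (coord0_itv n (p j)).
have [i intP] : exists i : 'I_n, forall j, coord n i.+1 (p j) \is a Num.int.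
  apply: contrapT => /forallNP nint.
  have {}nint (i : 'I_n) : exists j, coord n i.+1 (p j) \isn't a Num.int.
    have /existsNP[j /negP jP] := nint i. by exists j.
  (* [g] picks for each coordinate a point where it is non-integral. It is injective by [coordS_inj]
     and takes values in [S] by [coordS_int], so [S] would have at least [n] elements. *)
  have [g gP] := choice nint.
  move: Sn; rewrite ltnNge => /negP; apply.
  rewrite -[leqLHS]card_ord -(card_codom (f := g)); last first.
    by move=> i i' gE; apply/val_inj/(coordS_inj (gP i)); rewrite gE; exact: gP.
  apply: subset_leq_card; apply/fintype.subsetP => _ /codomP[i ->]; rewrite inE.
  by apply: contraNT (gP i); exact: coordS_int.
have : N%:R * delta \is a Num.int.
  by rewrite -(sumE (lift ord0 i)) rpred_sum// => j _; exact: intP.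
move/norm_intr_ge1 => /(_ (lt0r_neq0 Nd0)).
by rewrite gtr0_norm// leNgt Nd1.
Qed.

Definition example_space : set (R -> R) :=
  [set \sum_i b i *: centered i | b in [set: 'I_n.+1 -> R]].

Lemma scale_centeredE (b : 'I_n.+1 -> R) :
  \sum_i b i *: centered i = fun x => \sum_i b i * centered i x.
Proof. by rewrite fct_sumE. Qed.

Lemma example_continuous f : example_space f -> continuous f.
Proof.
move=> [b _ <-]; rewrite scale_centeredE; apply: sum_continuous => i x.
apply: cvgM; first exact: cvg_cst.
by apply: cvgB; [exact: coord_continuous|exact: cvg_cst].
Qed.

Lemma example_bounded f : example_space f -> bounded_fun f.
Proof.
move=> [b _ <-]; rewrite scale_centeredE.
exists (\sum_i `|b i| * (1 + `|mean i|)); split; first exact: num_real.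
move=> y /ltW My x _; apply: le_trans My => /=.
apply: le_trans (ler_norm_sum _ _ _) _; apply: ler_sum => i _.
rewrite normrM ler_wpM2l//; apply: le_trans (ler_normB _ _) _.
by rewrite lerD2r coord_norm_le1.
Qed.

Hypothesis n_gt0 : (0 < n)%N.
Hypothesis c_itv : 0 < c < 1.
Hypothesis delta_ge0 : 0 <= delta.
Hypothesis delta_lt1 : n%:R * delta < 1.

(** The three hypotheses on [K] treat the 0-th direction with positive coefficient, with negative
    coefficient, and the cross-polytope directions. The last clause gives both linear independence
    and a nonzero infimum. *)
Lemma example_bounds (K : R) (b : 'I_n.+1 -> R) :
  1 - c <= K * c -> c <= K * (1 - c) ->
  1 + n%:R * delta <= K * (1 - n%:R * delta) ->
  exists L, [/\ forall x, \sum_i b i * centered i x <= K * L,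
    exists x, \sum_i b i * centered i x <= - L,
    0 <= L & L = 0 -> forall i, b i = 0].
Proof.
set d := n%:R * delta => K1 K2 K3.
have /andP[c0 c1] := c_itv.
have d0 : 0 <= d by rewrite mulr_ge0.
have [k bk] : exists k : 'I_n, forall i : 'I_n,
    `|b (lift ord0 i)| <= `|b (lift ord0 k)|.
  have := @arg_maxP _ R _ (Ordinal n_gt0) xpredT
    (fun i => `|b (lift ord0 i)|) isT.
  case=> k _ kP.
  by exists k => i; exact: kP.
set B := `|b (lift ord0 k)| in bk.
have B0 : 0 <= B by exact: normr_ge0.
have sumd : `|delta * \sum_(i < n) b (lift ord0 i)| <= d * B.
  rewrite normrM (ger0_norm delta_ge0) /d [n%:R * _]mulrC -mulrA.
  rewrite ler_wpM2l//; apply: le_trans (ler_norm_sum _ _ _) _.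
  by rewrite mulr_natl -[X in _ *+ X]card_ord -sumr_const; exact: ler_sum.
set D := delta * _ in sumd; have /andP[D1 D2] : - (d * B) <= D <= d * B.
  by rewrite -ler_norml.
(* [- A] is the minimum of [b ord0 * (y - c)] for [y] in [0, 1]. *)
pose A := if 0 <= b ord0 then b ord0 * c else - b ord0 * (1 - c).
have A0 : 0 <= A.
  by rewrite /A; case: (leP 0 (b ord0)) => ?; apply: mulr_ge0; lra.
exists (A + (1 - d) * B); split.
- move=> x; rewrite centered_combE -/D.
  have := coord_sum_le x B0 bk; set T := \sum_(i < n) _ => TB.
  have /andP[f0 f1] := coord0_itv n x.
  suff : b ord0 * (coord n 0 x - c) <= K * A by nra.
  by rewrite /A; case: (leP 0 (b ord0)) => b0; nra.
(* The parity of [j] gives the dominant coordinate the sign opposite to its coefficient. Shifting by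
   1 from the center when [b ord0 < 0] leaves the spike but stays on the plateau, so the 0-th
   coordinate is 1 instead of 0. *)
- pose j := ((0 <= b (lift ord0 k))%R + k.+1.*2)%N.
  pose x : R := 4 * j%:R + (b ord0 < 0)%R%:R.
  have xj : isolated j x.
    apply: isolated_near; rewrite /x addrAC subrr add0r normr_nat ler_nat.
    by case: (_ < _)%R.
  have plx : plateau j x = 1.
    apply: plateau_eq1; rewrite /x addrAC subrr add0r normr_nat lern1.
    by case: (_ < _)%R.
  exists x; rewrite centered_combE -/D (coord0_isolated _ xj).
  have -> : (j < n.+1.*2)%N.
    apply: (@leq_ltn_trans (1 + k.+1.*2)); first by rewrite leq_add2r leq_b1.
    by rewrite add1n [n.+1.*2]doubleS !ltnS leq_double.
  have -> : \sum_(i < n) b (lift ord0 i) * coord n i.+1 x = - B.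
    have j2 : j./2 = k.+1 by rewrite /j half_bit_double.
    rewrite (bigD1 k)//= big1 ?addr0 => [|i ik]; last first.
      rewrite (coordS_isolated _ _ xj) j2 eqSS (_ : (_ == _) = false).
        by rewrite !mul0r mulr0.
      by apply/negbTE; rewrite eq_sym.
    rewrite (coordS_isolated _ _ xj) j2 eqxx plx mulr1 mul1r.
    rewrite /j oddD odd_double addbF oddb /B.
    case: (leP 0 (b (lift ord0 k))) => bk0.
      by rewrite expr1 mulrN1 ger0_norm.
    by rewrite expr0 mulr1 ltr0_norm// opprK.
  have -> : spike j x = (0 <= b ord0)%R%:R.
    rewrite /x; case: (leP 0 (b ord0)) => _.
      by rewrite addr0 spike_center.
    by rewrite spike_eq0// addrAC subrr add0r normr1.
  rewrite /A; case: (leP 0 (b ord0)) => b0 /=; nra.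
- by rewrite addr_ge0// mulr_ge0// subr_ge0 ltW.
move=> /eqP; rewrite paddr_eq0 => //; last by rewrite mulr_ge0// subr_ge0 ltW.
have d1 : 1 - d != 0 by rewrite subr_eq0 gt_eqF.
rewrite mulf_eq0 (negbTE d1) /= => /andP[/eqP A_eq0 /eqP B_eq0] i.
have [->|i0] := eqVneq i ord0.
  move: A_eq0; rewrite /A; case: (leP 0 (b ord0)) => b0 /eqP;
    by rewrite mulf_eq0; lra.
case: (unliftP ord0 i) i0 => [i' ->|->] // _.
by apply/eqP; rewrite -normr_le0 -B_eq0.
Qed.

Lemma example_has_dim : has_dim example_space n.+1.
Proof.
exists centered; split=> // b.
rewrite scale_centeredE => b0.
pose K := Num.max (Num.max ((1 - c) / c) (c / (1 - c)))
  ((1 + n%:R * delta) / (1 - n%:R * delta)).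
have /andP[c0 c1] := c_itv.
have [|||L [_ [x xL] L0 L_eq0]] := @example_bounds K b.
- by rewrite -ler_pdivrMr// !le_max lexx.
- by rewrite -ler_pdivrMr ?subr_gt0// !le_max lexx orbT.
- by rewrite -ler_pdivrMr ?subr_gt0// !le_max lexx orbT.
(* The zero combination takes a value at most [- L], which forces [L = 0]. *)
apply: L_eq0; apply/eqP; rewrite eq_le L0 andbT.
by move: xL; rewrite (congr1 (@^~ x) b0) oppr_ge0.
Qed.

End Example.

(** * Paths, the ratio bound and the measure *)

Lemma path_connected_real (R : realType) : path_connected R R.
Proof.
move=> x y; exists (fun t => x + t * (y - x)); split; last 2 first.
- by rewrite mul0r addr0.
- by rewrite mul1r addrC subrK.
apply: continuous_subspaceT => t; apply: cvgD; first exact: cvg_cst.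
by apply: cvgM; [exact: cvg_id|exact: cvg_cst].
Qed.

Lemma sup_inf_ratio_le (R : realType) (T : pointedType) (f : T -> R) (K L : R) :
  0 <= K -> 0 < L -> bounded_fun f -> (forall x, f x <= K * L) ->
  (exists x, f x <= - L) ->
  ((sup (range f))%:E / `|inf (range f)|%:E <= K%:E)%E.
Proof.
move=> K0 L0 bf fK [x fL].
have infL : inf (range f) <= - L.
  apply: le_trans fL; apply: ge_inf; last by exists x.
  exact: bounded_fun_has_lbound.
have Linf : L <= `|inf (range f)|.
  rewrite ler_normr; apply/orP; right; lra.
have inf0 := lt_le_trans L0 Linf.
rewrite inver gt_eqF// lee_pdivrMr// -EFinM lee_fin.
apply: (@le_trans _ _ (K * L)); last by rewrite ler_wpM2l.
by apply: ge_sup => [|_ [y _ <-]]; first by exists (f x), x.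
Qed.

(** The support points [8 j] have coordinates 0 for [j = 0], the [j]-th unit vector for
    [0 < j <= n], and, past the last spike, the 0-th unit vector for [j = n + 1]. *)
Lemma example_mean (R : realType) (n : nat) (c delta : R) (i : 'I_n.+1)
    (w : nat -> R) :
  w n.+1 = c -> (forall j, (0 < j <= n)%N -> w j = delta) ->
  \sum_(j < n.+2) w j = 1 ->
  \sum_(j < n.+2) w j * centered c delta i (4 * (j.*2)%:R) = 0.
Proof.
move=> wc wdelta w1; rewrite /centered.
under eq_bigr do rewrite mulrBr; rewrite sumrB -mulr_suml w1 mul1r.
apply/eqP; rewrite subr_eq0; apply/eqP.
have iso j : isolated j (4 * j%:R : R).
  by apply: isolated_near; rewrite subrr normr0.
have plateauE j : plateau j (4 * j%:R : R) = 1.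
  by apply: plateau_eq1; rewrite subrr normr0.
rewrite /mean; case: (unliftP ord0 i) => [k ->|->].
  rewrite eq_sym (negbTE (neq_lift _ _)).
  have kn : (k.+1 < n.+2)%N by rewrite ltnW// !ltnS.
  rewrite (bigD1 (Ordinal kn))//= big1 ?addr0 => [|j jk].
    rewrite (coordS_isolated _ _ (iso _)) doubleK eqxx odd_double plateauE.
    by rewrite expr0 !mulr1 wdelta //= ltn_ord.
  rewrite (coordS_isolated _ _ (iso _)) doubleK (_ : (_ == _) = false).
    by rewrite !mul0r mulr0.
  by apply/negbTE; rewrite -val_eqE in jk.
rewrite eqxx big_ord_recr/= big1 ?add0r => [|j _].
  by rewrite (coord0_isolated _ (iso _)) ltnn mul0r subr0 mulr1.
rewrite (coord0_isolated _ (iso _)) ltn_double ltn_ord spike_center.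
by rewrite mulr1 subrr mulr0.
Qed.

Lemma example_measure (R : realType) (n : nat) (c delta : R) :
  0 <= c -> 0 <= delta -> c + n%:R * delta <= 1 ->
  exists mu : probability (borelType R) R,
    forall f a, example_space n c delta f ->
      (\int[mu]_x (f x + a)%:E = a%:E)%E.
Proof.
move=> c0 delta0 cd.
have w0 : 0 <= 1 - c - n%:R * delta by rewrite -addrA -opprD subr_ge0.
pose w j : {nonneg R} := if j == 0%N then NngNum w0
  else if j == n.+1 then NngNum c0 else NngNum delta0.
have w1 : \sum_(j < n.+2) (w j)%:num = 1.
  rewrite big_ord_recr big_ord_recl/= /w/= eqxx.
  rewrite (eq_bigr (fun=> delta)) => [|j _]; last first.
    by rewrite /bump add1n/= eqSS ltn_eqF.
  rewrite sumr_const card_ord -[delta *+ _]mulr_natl -[_%:num]/c; ring.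
have [mu muE] :=
  @finitely_supported_probability _ (borelType R) R n.+2 w
    (fun j => 4 * (j.*2)%:R) w1.
exists mu => f a fE; rewrite (muE (fun x => f x + a)); last first.
  apply: continuous_borel_measurable => x.
  by apply: cvgD; [exact: (example_continuous fE)|exact: cvg_cst].
case: fE => b _ <-; congr EFin; rewrite scale_centeredE.
under eq_bigr do rewrite mulrDr mulr_sumr.
rewrite big_split -mulr_suml w1 mul1r exchange_big/= big1 ?add0r// => i _.
under eq_bigr do rewrite mulrCA; rewrite -mulr_sumr.
rewrite (@example_mean R n c delta i (fun j => (w j)%:num)) ?mulr0//.
- by rewrite /w /= eqxx.
- by move=> [|j]// /ltn_eqF jn; rewrite /w /= eqSS jn.
Qed.

(** * Choice of constants and conclusion *)

Theorem proposition9 (R : realType) (m : nat) (k eps : R)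
    (m_gt1 : (1 < m)%N) (k_ge1 : 1 <= k) (eps_gt0 : 0 < eps) :
  exists P : design_problem R,
    [/\ path_connected R P,
        has_dim (dp_V P) m,
        (dp_K P <= (k + eps)%:E)%E &
        forall N : nat, N%:R <= (m%:R - 1) * (k + 1) -> ~ admits_design P N].
Proof.
case: m m_gt1 => // n; rewrite ltnS => n0.
have nR0 : 0 < n%:R :> R by rewrite ltr0n.
(* This makes [e] both less than 1 and at most [eps]. *)
pose e := eps / (1 + eps).
have e0 : 0 < e by rewrite divr_gt0// addr_gt0.
have e1 : e < 1 by rewrite /e ltr_pdivrMr ?mul1r ?ltrDr// addr_gt0.
have e_eps : e <= eps.
  by rewrite /e ler_pdivrMr ?addr_gt0// mulrDr mulr1 lerDl mulr_ge0// ltW.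
(* Then [(1 - c) / c = k + e], and [n delta = e c] is small enough for the third inequality of
   [example_bounds] with [K = k + e]. *)
pose c := (k + 1 + e)^-1; pose delta := e * c / n%:R.
have ce : c * (k + 1 + e) = 1 by rewrite mulVf// gt_eqF//; lra.
have c0 : 0 < c by rewrite invr_gt0; lra.
have ndelta : n%:R * delta = e * c by rewrite mulrC divfK// gt_eqF.
have delta0 : 0 < delta by rewrite divr_gt0// mulr_gt0.
have c_itv : 0 < c < 1 by rewrite c0 /=; nra.
have ndelta1 : n%:R * delta < 1 by rewrite ndelta; nra.
have [mu muE] : exists mu : probability (borelType R) R,
    forall f a, example_space n c delta f ->
      (\int[mu]_x (f x + a)%:E = a%:E)%E.
  by apply: example_measure; rewrite ?ndelta ?ltW//; nra.
have dimW := example_has_dim n0 c_itv (ltW delta0) ndelta1.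
pose P := @DesignProblem R R mu (example_space n c delta)
  (ex_intro _ n.+1 dimW) (@example_continuous R n c delta)
  (@example_bounded R n c delta).
(* All functions of the space have mean zero, so an added constant must vanish. *)
have VE : dp_V P = example_space n c delta.
  apply/seteqP; split=> [f [[g Wg [a ->]]]|f Wf].
    rewrite /dp_integral muE// => /eqP; rewrite eqe => /eqP ->.
    by rewrite addr0.
  split; first by exists f => //; exists 0; rewrite addr0.
  by have := muE _ 0 Wf; under eq_integral do rewrite addr0.
exists P; split.
- exact: path_connected_real.
- by rewrite VE.
- apply: ge_ereal_sup => _ [f [Vf f_neq0] <-]; rewrite VE in Vf.
  have bf := example_bounded Vf.
  case: Vf f_neq0 bf => b _ <- f_neq0 bf.
  have [|||L [fK fL L0 L_eq0]] :=
    @example_bounds R n c delta n0 c_itv (ltW delta0) ndelta1 (k + e) b.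
  + nra.
  + nra.
  + rewrite ndelta; nra.
  have Lgt0 : 0 < L.
    rewrite lt_neqAle L0 andbT; apply/eqP => L00; apply: f_neq0.
    by rewrite /= big1// => i _; rewrite L_eq0// scale0r.
  apply: (@le_trans _ _ (k + e)%:E); last by rewrite lee_fin lerD2l.
  apply: (@sup_inf_ratio_le _ _ _ _ L _ Lgt0 bf); first by lra.
  + by move=> x; rewrite scale_centeredE; exact: fK.
  + by have [x xL] := fL; exists x; rewrite scale_centeredE.
- move=> N Nle [p [N0 pP]].
  have NR0 : 0 < N%:R :> R by rewrite ltr0n.
  rewrite -natr1 addrK in Nle.
  apply: (@no_centered_zero_sum R n c delta N p).
  (* [N c <= n (k + 1) c = n (1 - e c) < n]; dividing by [n] also gives [N delta < e < 1]. *)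
  + by nra.
  + apply/andP; split; first exact: mulr_gt0.
    have := Nle; rewrite -(ler_pM2r c0) => Nc; nra.
  + move=> i; have Wi : example_space n c delta (centered c delta i).
      exists (fun j => (j == i)%:R) => //.
      rewrite (bigD1 i)//= eqxx scale1r big1 ?addr0// => j /negbTE ->.
      by rewrite scale0r.
    have := pP _ Wi; have := muE _ 0 Wi.
    under eq_integral do rewrite addr0.
    rewrite /dp_integral => -> /esym/eqP.
    by rewrite eqe mulf_eq0 invr_eq0 gt_eqF//= => /eqP.
Qed.
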